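(* Every commutative Moufang groupoid $M$ is a semilattice of Archimedean groupoids; that is, there exists a congruence $\theta$ on $M$ such that the quotient $M/\theta$ is a semilattice and each $\theta$-class is a subgroupoid of $M$ which is Archimedean.
   Context: A groupoid is a set with a binary operation, written as juxtaposition (no associativity is assumed). A Moufang groupoid is a groupoid satisfying the identity $(xy)(zx)=(x(yz))x$ for all elements $x,y,z$; it is commutative if $xy=yx$ for all $x,y$. Powers of an element are $a^1=a$, $a^{n+1}=a\,a^n$ (in a commutative Moufang groupoid the value of a product of $n$ copies of $a$ does not depend on the bracketing). An ideal of a commutative groupoid $N$ is a subset $I$ with $xy\in I$ for all $x\in N$, $y\in I$; the principal ideal of $N$ generated by $b\in N$ is the smallest ideal of $N$ containing $b$, i.e. the set of all elements $x_1(x_2(\cdots(x_k b)\cdots))$ with $k\ge 0$ and $x_i\in N$. A commutative Moufang groupoid $N$ is called Archimedean if for all $a,b\in N$ there exist $n,m\ge 1$ such that $a^n$ lies in the principal ideal of $N$ generated by $b$ and $b^m$ lies in the principal ideal of $N$ generated by $a$ (ideals being taken in $N$ itself). A congruence is an equivalence relation compatible with the operation. A semilattice is a commutative, associative, idempotent groupoid. *)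

(* Defs.v *)
(* A groupoid (set with a binary operation) is a [magmaType],
   which carries no choice or decidable-equality structure. *)
From HB Require Import structures.
From mathcomp Require Import all_boot.
From Stdlib Require Import RelationClasses Morphisms.

Set Implicit Arguments.
Unset Strict Implicit.
Unset Printing Implicit Defensive.

Local Open Scope group_scope.

Definition moufang (M : magmaType) : Prop :=
  forall x y z : M, (x * y) * (z * x) = (x * (y * z)) * x.

Definition commutative_moufang (M : magmaType) : Prop :=
  commutative (@mul M) /\ moufang M.

Definition semilattice (M : magmaType) : Prop :=
  [/\ commutative (@mul M), associative (@mul M) & idempotent_op (@mul M)].

(* Right-nested power a (a (... a)) with n factors.  The exponent 0 is
   meaningless in a magma; [gpow a 0] is the junk value a, and the power is
   only used with 1 <= n. *)
Definition gpow (M : magmaType) (a : M) (n : nat) : M :=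
  iter n.-1 (mul a) a.

(* One-sided absorption is the right notion because it is only used for
   commutative magmas. *)
Definition ideal (M : magmaType) (I : M -> Prop) : Prop :=
  forall x y : M, I y -> I (x * y).

Definition principal_ideal (M : magmaType) (b : M) : M -> Prop :=
  fun x => forall I : M -> Prop, ideal I -> I b -> I x.

Definition archimedean (N : magmaType) : Prop :=
  commutative_moufang N /\
  forall a b : N, exists n m : nat,
    [/\ (1 <= n)%N, (1 <= m)%N, principal_ideal b (gpow a n)
      & principal_ideal a (gpow b m)].

Definition closed_mul (M : magmaType) (A : M -> Prop) : Prop :=
  forall x y : M, A x -> A y -> A (x * y).

Definition subgroupoid (M : magmaType) (A : M -> Prop) (cA : closed_mul A) :
  Type := {x : M | A x}.

Definition subgroupoid_mul (M : magmaType) (A : M -> Prop) (cA : closed_mul A)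
    (u v : subgroupoid cA) : subgroupoid cA :=
  exist A (proj1_sig u * proj1_sig v) (cA _ _ (proj2_sig u) (proj2_sig v)).

HB.instance Definition _ (M : magmaType) (A : M -> Prop) (cA : closed_mul A) :=
  hasMul.Build (subgroupoid cA) (@subgroupoid_mul M A cA).

Record congruence (M : magmaType) := Congruence {
  cong_rel :> M -> M -> Prop;
  cong_equiv : Equivalence cong_rel;
  cong_mul : Proper (cong_rel ==> cong_rel ==> cong_rel) (@mul M)
}.

Definition is_class (M : magmaType) (theta : congruence M) (A : M -> Prop) :
  Prop := exists a : M, forall x : M, A x <-> theta a x.

Definition quotient (M : magmaType) (theta : congruence M) : Type :=
  {A : M -> Prop | is_class theta A}.

(* The class containing the products x * y with x in A and y in B. *)
Definition class_mul (M : magmaType) (theta : congruence M)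
    (A B : M -> Prop) : M -> Prop :=
  fun z => exists x y : M, [/\ A x, B y & theta (x * y) z].

Lemma class_mulP (M : magmaType) (theta : congruence M) (A B : M -> Prop) :
  is_class theta A -> is_class theta B -> is_class theta (class_mul theta A B).
Proof.
case: (cong_equiv theta) => refl sym trans [a Aa] [b Bb].
exists (a * b) => z; split=> [[x [y [/Aa ax /Bb bY xyz]]]|abz].
  by apply: trans xyz; apply: cong_mul.
by exists a, b; split=> //; [apply/Aa | apply/Bb].
Qed.

Definition quotient_mul (M : magmaType) (theta : congruence M)
    (u v : quotient theta) : quotient theta :=
  exist (is_class theta) (class_mul theta (proj1_sig u) (proj1_sig v))
    (class_mulP (proj2_sig u) (proj2_sig v)).

HB.instance Definition _ (M : magmaType) (theta : congruence M) :=
  hasMul.Build (quotient theta) (@quotient_mul M theta).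

(* Main.v *)
Require Import Defs.
From HB Require Import structures.
From mathcomp Require Import all_boot.
From Stdlib Require Import RelationClasses Morphisms.
From Stdlib Require Import FunctionalExtensionality PropExtensionality.
From Stdlib Require Import ProofIrrelevance.

(** The congruence is mutual divisibility up to powers: write [a <= b] when some
    power of [b] lies in the principal ideal of [a], and let [theta] be the
    equivalence attached to this preorder, as for commutative semigroups.
    Everything rests on reading the Moufang law, in the commutative case, as
    [(c x) (c y) = c (c (x y))], which iterates to
    [L_c^m x * L_c^m y = L_c^(2m) (x y)], where [L_c] is multiplication by [c]
    ([iter_mul_distr]).

    With [x = y] this law shows that squaring sends the ideal of [b] into the
    ideal of [b^2], hence that [<=] is transitive: powers with exponent [2^k]
    replace the law [(x b)^n = x^n b^n] of semigroups ([divides_power_trans]).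
    With [x] a multiplier it lets a high power of [L_c] pass through a tower
    [x_1 (x_2 (... a))] and reach [a], so that [L_c^m] carries any given element
    of the ideal of [a] into the ideal of [c a].  If [b^n] is in the ideal of
    [a], then some power of [c b] has a factor [L_c^m (b^n)] with [m] large enough
    for this.  Hence [<=] is stable under multiplication ([divides_power_mul2l]),
    and [a b <= x] holds exactly when [a <= x] and [b <= x]
    ([divides_power_mul]).  The last equivalence says that
    [a b] is the join of [a] and [b] for [<=], and so the quotient is a
    semilattice.

    Finally let [a] and [b] be in one class, with [a^n = x_1 (x_2 (... b))].  The
    multipliers [x_i] need not be in the class, but they divide [a^n], whence
    [x_i <= a] and [L_a^m x_i] is in the class for [m >= 1].  The same passage of
    [L_a^m] through the tower replaces each [x_i] by such an element, and writes a
    higher power of [a] with multipliers in the class only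
    ([class_principal_ideal]). *)

Set Implicit Arguments.
Unset Strict Implicit.
Unset Printing Implicit Defensive.

Local Open Scope group_scope.

(** * Principal ideals and powers *)

Lemma principal_ideal_refl (M : magmaType) (b : M) : principal_ideal b b.
Proof. by []. Qed.

Lemma principal_ideal_mull (M : magmaType) (b x y : M) :
  principal_ideal b y -> principal_ideal b (x * y).
Proof. by move=> Jy I idI Ib; exact: (idI x y (Jy I idI Ib)). Qed.

Lemma principal_ideal_trans (M : magmaType) (a b c : M) :
  principal_ideal a b -> principal_ideal b c -> principal_ideal a c.
Proof. by move=> Jb Jc I idI Ia; exact: (Jc I idI (Jb I idI Ia)). Qed.

Lemma principal_ideal_iter (M : magmaType) (b c y : M) (n : nat) :
  principal_ideal b y -> principal_ideal b (iter n (mul c) y).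
Proof. by move=> Jy; elim: n => //= n; apply: principal_ideal_mull. Qed.

(* Exponents are positive, hence the successor. *)
Lemma iter_gpow (M : magmaType) (a : M) (m n : nat) :
  iter m (mul a) (gpow a n.+1) = gpow a (m + n).+1.
Proof. by rewrite /gpow /= -iterD. Qed.

Lemma principal_ideal_gpow (M : magmaType) (a b : M) (n m : nat) :
  (0 < n <= m)%N -> principal_ideal a (gpow b n) ->
  principal_ideal a (gpow b m).
Proof.
case: n => // n; case: m => // m /= le_nm Jn.
by rewrite -(subnK (le_nm : n <= m)%N) -iter_gpow; apply: principal_ideal_iter.
Qed.

Lemma mul_distr (M : magmaType) (hM : commutative_moufang M) (c x y : M) :
  (c * x) * (c * y) = c * (c * (x * y)).
Proof. by case: hM => mulC hM; rewrite (mulC c y) hM mulC. Qed.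

Lemma iter_mul_distr (M : magmaType) (hM : commutative_moufang M)
    (c x y : M) (m : nat) :
  iter m (mul c) x * iter m (mul c) y = iter m.*2 (mul c) (x * y).
Proof. by elim: m => //= m IHm; rewrite mul_distr // IHm. Qed.

(** The distributive law removes one factor from both powers at a time. *)
Lemma gpowD (M : magmaType) (hM : commutative_moufang M) (a : M) (m n : nat) :
  (0 < m)%N -> (0 < n)%N -> gpow a m * gpow a n = gpow a (m + n).
Proof.
case: m => // m _; case: n => // n _; elim: m n => [|m IHm] [|n] //.
  by case: hM => mulC _; rewrite mulC addn1.
rewrite -[gpow a m.+2]/(a * gpow a m.+1) -[gpow a n.+2]/(a * gpow a n.+1).
by rewrite mul_distr // IHm [(m.+2 + _)%N]addnS.
Qed.

Definition sqr (M : magmaType) (x : M) : M := x * x.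

Lemma iter_sqr (M : magmaType) (hM : commutative_moufang M) (a : M) (k : nat) :
  iter k (@sqr M) a = gpow a (2 ^ k).
Proof.
by elim: k => //= k ->; rewrite /sqr gpowD ?expn_gt0 // addnn -mul2n expnS.
Qed.

Lemma iter_sqr_mul (M : magmaType) (hM : commutative_moufang M)
    (c x : M) (k : nat) :
  iter k (@sqr M) (c * x) = iter (2 ^ k) (mul c) (iter k (@sqr M) x).
Proof.
elim: k => //= k ->; rewrite {1}/sqr iter_mul_distr //.
by rewrite -mul2n expnS.
Qed.

Lemma principal_ideal_sqr (M : magmaType) (hM : commutative_moufang M)
    (b y : M) :
  principal_ideal b y -> principal_ideal (sqr b) (sqr y).
Proof.
move=> Jy; apply: (Jy (fun z => principal_ideal (sqr b) (sqr z))) => // x z Jz.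
by rewrite /sqr mul_distr //; do 2!apply: principal_ideal_mull.
Qed.

Lemma principal_ideal_iter_sqr (M : magmaType) (hM : commutative_moufang M)
    (b y : M) (k : nat) :
  principal_ideal b y ->
  principal_ideal (iter k (@sqr M) b) (iter k (@sqr M) y).
Proof. by move=> Jy; elim: k => //= k; apply: principal_ideal_sqr. Qed.

(** * Divisibility up to powers *)

Definition divides_power (M : magmaType) (a b : M) : Prop :=
  exists n, (0 < n)%N /\ principal_ideal a (gpow b n).

Lemma principal_ideal_divides_power (M : magmaType) (a b : M) :
  principal_ideal a b -> divides_power a b.
Proof. by move=> Jb; exists 1%N. Qed.

Lemma divides_power_refl (M : magmaType) (a : M) : divides_power a a.
Proof. exact: principal_ideal_divides_power (@principal_ideal_refl M a). Qed.

(** If [c^m] is in the ideal of [b] then [c^(m 2^k)] is in that of [b^(2^k)], and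
    [2^k] eventually exceeds any exponent. *)
Lemma divides_power_trans (M : magmaType) (hM : commutative_moufang M)
    (a b c : M) :
  divides_power a b -> divides_power b c -> divides_power a c.
Proof.
move=> [n [n0 Jn]] [m [m0 Jm]]; have lt_n := ltn_expl n (isT : 1 < 2)%N.
have Ja : principal_ideal a (gpow b (2 ^ n)).
  by apply: principal_ideal_gpow Jn; rewrite n0 ltnW.
have gpow_sqr k : exists p, (0 < p)%N /\ iter k (@sqr M) (gpow c m) = gpow c p.
  elim: k => [|k [p [p0 Ep]]]; first by exists m.
  by exists (p + p)%N; rewrite addn_gt0 p0 /= Ep /sqr gpowD.
have [p [p0 Ep]] := gpow_sqr n; exists p; split=> //.
apply: principal_ideal_trans Ja _; rewrite -Ep -iter_sqr //.
exact: principal_ideal_iter_sqr.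
Qed.

(** Each multiplier in a tower over [a] doubles the exponent required:
    [L_c^(2m) (x y) = L_c^m x * L_c^m y]. *)
Lemma principal_ideal_iter_mul (M : magmaType) (hM : commutative_moufang M)
    (a c y : M) :
  principal_ideal a y ->
  exists m, principal_ideal (c * a) (iter m (mul c) y).
Proof.
pose I z := exists m, principal_ideal (c * a) (iter m (mul c) z).
move=> Jy; apply: (Jy I) => [x z [m Jm]|]; last by exists 1%N.
by exists m.*2; rewrite -iter_mul_distr //; apply: principal_ideal_mull.
Qed.

(** In [(c b)^(2^(k+1)) = L_c^(2^(k+1)) (b^(2^(k+1)))] split the power of [b]
    unevenly, as [b^n b^(2^(k+1) - n)] with [b^n] in the ideal of [a]; one factor
    is then [L_c^(2^k) (b^n)].  An even split would be useless: the number of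
    factors [c] needed to reach [c a] depends on the power of [b], so this power
    must not grow with [k]. *)
Lemma divides_power_mul2l (M : magmaType) (hM : commutative_moufang M)
    (a b c : M) :
  divides_power a b -> divides_power (c * a) (c * b).
Proof.
case=> n [n0 Jn]; have [m Jm] := principal_ideal_iter_mul hM c Jn.
have lt_nm := ltn_expl (n + m) (isT : 1 < 2)%N.
have le_m : (m <= 2 ^ (n + m))%N.
  by apply: leq_trans (ltnW lt_nm); apply: leq_addl.
have lt_n : (n < 2 ^ (n + m).+1)%N.
  apply: leq_ltn_trans (leq_addr m n) (ltn_trans lt_nm _).
  by rewrite ltn_exp2l.
exists (2 ^ (n + m).+1)%N; split; first by rewrite expn_gt0.
rewrite -iter_sqr // iter_sqr_mul // iter_sqr // -{2}(subnK (ltnW lt_n)).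
rewrite -gpowD ?subn_gt0 // expnS mul2n -iter_mul_distr //.
apply: principal_ideal_mull; rewrite -(subnK le_m) iterD.
exact: principal_ideal_iter.
Qed.

Lemma divides_power_mulr (M : magmaType) (a x : M) : divides_power a (x * a).
Proof.
apply: principal_ideal_divides_power.
exact: principal_ideal_mull (@principal_ideal_refl M a).
Qed.

(** For the converse direction, [a b <= x b <= x x <= x]. *)
Lemma divides_power_mul (M : magmaType) (hM : commutative_moufang M)
    (a b x : M) :
  divides_power (a * b) x <-> divides_power a x /\ divides_power b x.
Proof.
have mulC := proj1 hM; split=> [abx | [ax bx]].
  split; apply: (divides_power_trans hM _ abx);
    last exact: divides_power_mulr.
  by rewrite mulC; apply: divides_power_mulr.
apply: (divides_power_trans hM (divides_power_mul2l hM a bx)); rewrite mulC.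
apply: (divides_power_trans hM (divides_power_mul2l hM x ax)).
by exists 2%N; split=> //; apply: principal_ideal_refl.
Qed.

(** * The congruence and its quotient *)

Definition mutually_divides_power (M : magmaType) (a b : M) : Prop :=
  divides_power a b /\ divides_power b a.

Lemma mutually_divides_powerP (M : magmaType) (hM : commutative_moufang M)
    (a b : M) :
  mutually_divides_power a b <->
  forall x, divides_power a x <-> divides_power b x.
Proof.
split=> [[ab ba] x | eq_ab]; first by split; apply: divides_power_trans.
by split; apply/eq_ab; apply: divides_power_refl.
Qed.

Lemma mutually_divides_power_equiv (M : magmaType)
    (hM : commutative_moufang M) :
  Equivalence (@mutually_divides_power M).
Proof.
split=> [a | a b [] | a b c [ab ba] [bc cb]]; [split | split | split] => //.
- exact: divides_power_refl.
- exact: divides_power_refl.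
- exact: divides_power_trans bc.
- exact: divides_power_trans ba.
Qed.

Lemma mutually_divides_power_mul (M : magmaType) (hM : commutative_moufang M) :
  Proper (@mutually_divides_power M ==> @mutually_divides_power M
          ==> @mutually_divides_power M) (@mul M).
Proof.
move=> a a' /(mutually_divides_powerP hM) aa' b b'.
move=> /(mutually_divides_powerP hM) bb'; apply/(mutually_divides_powerP hM).
by move=> x; rewrite !divides_power_mul // aa' bb'.
Qed.

Definition archimedean_congruence (M : magmaType)
    (hM : commutative_moufang M) : congruence M :=
  Congruence (mutually_divides_power_equiv hM) (mutually_divides_power_mul hM).

Lemma quotient_eq (M : magmaType) (theta : congruence M)
    (u v : quotient theta) (a b : M) :
  (forall x, sval u x <-> theta a x) -> (forall x, sval v x <-> theta b x) ->
  theta a b -> u = v.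
Proof.
case: (cong_equiv theta) => refl sym trans.
case: u v => [A clA] [B clB] /= Aa Bb ab; apply: subset_eq_compat.
apply: functional_extensionality => x; apply: propositional_extensionality.
rewrite Aa Bb; split; apply: trans => //; exact: sym.
Qed.

Lemma quotient_mulE (M : magmaType) (theta : congruence M)
    (u v : quotient theta) (a b : M) :
  (forall x, sval u x <-> theta a x) -> (forall x, sval v x <-> theta b x) ->
  forall x, sval (u * v) x <-> theta (a * b) x.
Proof.
case: (cong_equiv theta) => refl sym trans ua vb z.
split=> [[x [y [/ua ax /vb bY xyz]]] | abz].
  by apply: trans xyz; apply: cong_mul.
by exists a, b; split=> //; [apply/ua | apply/vb].
Qed.

Lemma semilattice_quotient (M : magmaType) (theta : congruence M) :
  (forall a b, theta (a * b) (b * a)) ->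
  (forall a b c, theta (a * (b * c)) (a * b * c)) ->
  (forall a, theta (a * a) a) ->
  semilattice (quotient theta).
Proof.
move=> thC thA thI; split=> [u v | u v w | u].
- have [[a ua] [b vb]] := (proj2_sig u, proj2_sig v).
  exact: quotient_eq (quotient_mulE ua vb) (quotient_mulE vb ua) _.
- have [[a ua] [b vb]] := (proj2_sig u, proj2_sig v).
  have [c wc] := proj2_sig w.
  exact: quotient_eq (quotient_mulE ua (quotient_mulE vb wc))
                     (quotient_mulE (quotient_mulE ua vb) wc) _.
- have [a ua] := proj2_sig u.
  exact: quotient_eq (quotient_mulE ua ua) ua _.
Qed.

(** Both sides of each law lie below the same elements, by
    [divides_power_mul]. *)
Lemma semilattice_archimedean_quotient (M : magmaType)
    (hM : commutative_moufang M) :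
  semilattice (quotient (archimedean_congruence hM)).
Proof.
apply: semilattice_quotient => [a b | a b c | a];
  apply/(mutually_divides_powerP hM) => x;
  rewrite !divides_power_mul //; tauto.
Qed.

(** * The classes *)

Lemma class_mul_closed (M : magmaType) (theta : congruence M)
    (thI : forall a, theta (a * a) a) (A : M -> Prop) :
  is_class theta A -> closed_mul A.
Proof.
case: (cong_equiv theta) => refl sym trans [a Aa] x y /Aa ax /Aa ay.
by apply/Aa; apply: trans (sym _ _ (thI a)) _; apply: cong_mul.
Qed.

Lemma subgroupoid_eq (M : magmaType) (A : M -> Prop) (cA : closed_mul A)
    (u v : subgroupoid cA) : sval u = sval v -> u = v.
Proof. by case: u v => [x Ax] [y Ay]; apply: subset_eq_compat. Qed.

Lemma subgroupoid_commutative_moufang (M : magmaType)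
    (hM : commutative_moufang M) (A : M -> Prop) (cA : closed_mul A) :
  commutative_moufang (subgroupoid cA).
Proof.
case: hM => mulC hM.
by split=> [u v | u v w]; apply: subgroupoid_eq; [apply: mulC | apply: hM].
Qed.

Lemma sval_iter_mul (M : magmaType) (A : M -> Prop) (cA : closed_mul A)
    (u v : subgroupoid cA) (n : nat) :
  sval (iter n (mul u) v) = iter n (mul (sval u)) (sval v).
Proof. by elim: n => //= n ->. Qed.

(** A multiplier [x] in the tower from [b] to [y] divides [y], so [x <= a] and
    [L_a^m x] is in the class of [a] as soon as [m >= 1]. *)
Lemma class_principal_ideal (M : magmaType) (hM : commutative_moufang M)
    (A : M -> Prop) (cA : closed_mul A)
    (clA : is_class (archimedean_congruence hM) A)
    (a b : subgroupoid cA) (y : M) :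
  principal_ideal (sval b) y -> divides_power y (sval a) ->
  exists m (u : subgroupoid cA),
    sval u = iter m.+1 (mul (sval a)) y /\ principal_ideal b u.
Proof.
have [c Ac] := clA; have [refl sym trans] := mutually_divides_power_equiv hM.
pose I z := divides_power z (sval a) -> exists m (u : subgroupoid cA),
  sval u = iter m.+1 (mul (sval a)) z /\ principal_ideal b u.
move=> Jy; apply: (Jy I) => [x z Iz | _]; last first.
  exists 0%N, (a * b); split=> //.
  exact: principal_ideal_mull (@principal_ideal_refl _ b).
move=> /(divides_power_mul hM)[xa /Iz[m [u [Eu Ju]]]].
have Ax : A (iter m.+1 (mul (sval a)) x).
  have ca := proj1 (Ac _) (proj2_sig a).
  apply/Ac; apply: trans ca _; apply/(mutually_divides_powerP hM) => w.
  have aw_xw : divides_power (sval a) w -> divides_power x w.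
    exact: divides_power_trans.
  elim: m {Eu} => [|m IHm]; rewrite iterS divides_power_mul //.
    by split=> [aw | []] //; split=> //; apply: aw_xw.
  by rewrite -IHm; split=> [|[]].
pose v : subgroupoid cA := exist A _ Ax.
exists m.*2.+1, (v * u); split; last exact: principal_ideal_mull.
rewrite -[sval (v * u)]/(iter m.+1 (mul (sval a)) x * sval u) Eu.
by rewrite iter_mul_distr.
Qed.

Lemma class_divides_power (M : magmaType) (hM : commutative_moufang M)
    (A : M -> Prop) (cA : closed_mul A)
    (clA : is_class (archimedean_congruence hM) A) (a b : subgroupoid cA) :
  divides_power b a.
Proof.
have [c Ac] := clA; have [refl sym trans] := mutually_divides_power_equiv hM.
have ca := proj1 (Ac _) (proj2_sig a); have cb := proj1 (Ac _) (proj2_sig b).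
have [[[|n] [// _ Jn]] _] := trans _ _ _ (sym _ _ cb) ca.
have gpow_a : divides_power (gpow (sval a) n.+1) (sval a).
  by exists n.+1; split=> //; apply: principal_ideal_refl.
have [m [u [Eu Ju]]] := class_principal_ideal clA Jn gpow_a.
exists (m.+1 + n).+1; split=> //; suff <- : u = gpow a (m.+1 + n).+1 by [].
by apply: subgroupoid_eq; rewrite Eu iter_gpow /gpow sval_iter_mul.
Qed.

Theorem theorem9 (M : magmaType) (hM : commutative_moufang M) :
  exists theta : congruence M,
    semilattice (quotient theta) /\
    forall A : M -> Prop, is_class theta A ->
      exists cA : closed_mul A, archimedean (subgroupoid cA).
Proof.
exists (archimedean_congruence hM); split=> [|A clA].
  exact: semilattice_archimedean_quotient.
have idem a : archimedean_congruence hM (a * a) a.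
  apply/(mutually_divides_powerP hM) => x.
  by rewrite divides_power_mul //; tauto.
exists (class_mul_closed idem clA); split=> [|a b].
  exact: subgroupoid_commutative_moufang.
have [n [n0 Jn]] := class_divides_power clA a b.
have [m [m0 Jm]] := class_divides_power clA b a.
by exists n, m.
Qed.
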